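(* Let $(A,\ast,\alpha)$ be a Hom-alternative algebra, $(V,\mathfrak l,\mathfrak r,\beta)$ a bimodule of it, and $T:V\to A$ an $\mathcal O$-operator of $(A,\ast,\alpha)$ with respect to $(V,\mathfrak l,\mathfrak r,\beta)$. Then $(V,\prec,\succ,\beta)$ is a Hom-pre-alternative algebra, where for all $a,b\in V$, $$a\succ b=\mathfrak l(T(a))b,\qquad a\prec b=\mathfrak r(T(b))a.$$ Moreover, if $(V,\cdot,\beta)$ is the Hom-pre-Malcev algebra associated (through $T$) to the Hom-Malcev admissible algebra $(A,[-,-],\alpha)$ on the module $(V,\mathfrak l-\mathfrak r,\beta)$, then $a\cdot b=a\succ b-b\prec a$ for all $a,b\in V$.
   Context: All vector spaces are over a field $\mathbb K$ of characteristic $0$. A Hom-algebra $(A,\mu,\alpha)$ is a vector space $A$ with a bilinear map $\mu:A\otimes A\to A$ and a linear map $\alpha:A\to A$; Hom-algebras are assumed multiplicative, i.e. $\alpha(\mu(x,y))=\mu(\alpha(x),\alpha(y))$. A Hom-alternative algebra is a Hom-algebra $(A,\ast,\alpha)$ with $as_\alpha(x,x,y)=as_\alpha(y,x,x)=0$ for all $x,y\in A$, where $as_\alpha(x,y,z)=(x\ast y)\ast\alpha(z)-\alpha(x)\ast(y\ast z)$. Its Hom-Malcev admissible algebra is $(A,[-,-],\alpha)$ with $[x,y]=x\ast y-y\ast x$; it is a Hom-Malcev algebra, i.e. a Hom-algebra with anti-symmetric bracket satisfying $J_\alpha(\alpha(x),\alpha(y),[x,z])=[J_\alpha(x,y,z),\alpha^2(x)]$,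 where $J_\alpha(x,y,z)=[[x,y],\alpha(z)]+[[y,z],\alpha(x)]+[[z,x],\alpha(y)]$. A bimodule of a Hom-alternative algebra $(A,\ast,\alpha)$ with respect to a linear map $\beta:V\to V$ on a vector space $V$ is given by linear maps $\mathfrak l,\mathfrak r:A\to\mathrm{End}(V)$ such that for all $x,y\in A$ (with $x^2=x\ast x$): $\mathfrak l(x^2)\beta=\mathfrak l(\alpha(x))\mathfrak l(x)$; $\mathfrak r(x^2)\beta=\mathfrak r(\alpha(x))\mathfrak r(x)$; $\mathfrak r(\alpha(y))\mathfrak l(x)-\mathfrak l(\alpha(x))\mathfrak r(y)=\mathfrak r(x\ast y)\beta-\mathfrak r(\alpha(y))\mathfrak r(x)$; $\mathfrak l(y\ast x)\beta-\mathfrak l(\alpha(y))\mathfrak l(x)=\mathfrak l(\alpha(y))\mathfrak r(x)-\mathfrak r(\alpha(x))\mathfrak l(y)$. An $\mathcal O$-operator of $(A,\ast,\alpha)$ with respect to $(V,\mathfrak l,\mathfrak r,\beta)$ is a linear map $T:V\to A$ with $\alpha\circ T=T\circ\beta$ and $T(a)\ast T(b)=T(\mathfrak l(T(a))b+\mathfrak r(T(b))a)$ for all $a,b\in V$. A Hom-pre-alternative algebra is a quadruple $(A,\prec,\succ,\alpha)$ consisting of a vector space $A$, bilinear maps $\prec,\succ:A\otimes A\to A$ and a linear map $\alpha:A\to A$ such that for all $x,y,z\in A$, with $x\ast y=x\prec y+x\succ y$: $(x\succ y)\prec\alpha(z)-\alpha(x)\succ(y\prec z)+(y\prec x)\prec\alpha(z)-\alpha(y)\prec(x\ast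 z)=0$; $(x\succ y)\prec\alpha(z)-\alpha(x)\succ(y\prec z)+(x\ast z)\succ\alpha(y)-\alpha(x)\succ(z\succ y)=0$; $(x\ast y)\succ\alpha(z)-\alpha(x)\succ(y\succ z)+(y\ast x)\succ\alpha(z)-\alpha(y)\succ(x\succ z)=0$; $(x\prec y)\prec\alpha(z)-\alpha(x)\prec(y\ast z)+(x\prec z)\prec\alpha(y)-\alpha(x)\prec(z\ast y)=0$. A Hom-pre-Malcev algebra is a Hom-algebra $(A,\cdot,\alpha)$ such that, with $[x,y]=x\cdot y-y\cdot x$, for all $x,y,z,t\in A$, $$[\alpha(y),\alpha(z)]\cdot\alpha(x\cdot t)+[[x,y],\alpha(z)]\cdot\alpha^2(t)+\alpha^2(y)\cdot([x,z]\cdot\alpha(t))-\alpha^2(x)\cdot(\alpha(y)\cdot(z\cdot t))+\alpha^2(z)\cdot(\alpha(x)\cdot(y\cdot t))=0.$$ Given a module $(V,\rho,\beta)$ of a Hom-Malcev algebra $(A,[-,-],\alpha)$ and a linear map $T:V\to A$ with $\alpha\circ T=T\circ\beta$ and $[T(a),T(b)]=T(\rho(T(a))b-\rho(T(b))a)$, the associated Hom-pre-Malcev algebra on $V$ is $(V,\cdot,\beta)$ with product $a\cdot b=\rho(T(a))b$; here it is taken with $\rho=\mathfrak l-\mathfrak r$. *)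

(* Defs.v *)
From HB Require Import structures.
From mathcomp Require Import all_boot all_order all_algebra.

Set Implicit Arguments.
Unset Strict Implicit.
Unset Printing Implicit Defensive.

Import GRing.Theory.
Local Open Scope ring_scope.

(* Spaces are arbitrary K-modules, of possibly infinite dimension. A linear
   map A -> End(V) is represented by the equivalent bilinear map A -> V -> V. *)

Section Operations.
Variables (K : fieldType) (A V : lmodType K).

Definition commutator (mu : {bilinear A -> A -> A}) (x y : A) : A :=
  mu x y - mu y x.

Definition hom_associator (mu : {bilinear A -> A -> A})
    (alpha : {linear A -> A}) (x y z : A) : A :=
  mu (mu x y) (alpha z) - mu (alpha x) (mu y z).

Definition rep_sub (l r : {bilinear A -> V -> V}) (x : A) (v : V) : V :=
  l x v - r x v.

Definition induced_succ (l : {bilinear A -> V -> V}) (T : {linear V -> A})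
    (a b : V) : V := l (T a) b.

Definition induced_prec (r : {bilinear A -> V -> V}) (T : {linear V -> A})
    (a b : V) : V := r (T b) a.

End Operations.

Section Bilinearity.
Variables (K : fieldType) (A V : lmodType K).

Lemma commutator_is_bilinear (mu : {bilinear A -> A -> A}) :
  bilinear_for *:%R *:%R (commutator mu).
Proof.
split=> [u'|u] k x y; rewrite /commutator linearPl linearPr /=;
  by rewrite opprD addrACA scalerBr.
Qed.

HB.instance Definition _ mu :=
  bilinear_isBilinear.Build K A A A *:%R *:%R (commutator mu)
    (commutator_is_bilinear mu).

Lemma rep_sub_is_bilinear (l r : {bilinear A -> V -> V}) :
  bilinear_for *:%R *:%R (rep_sub l r).
Proof.
split=> [u'|u] k x y; rewrite /rep_sub ?linearPl ?linearPr /=;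
  by rewrite opprD addrACA scalerBr.
Qed.

HB.instance Definition _ l r :=
  bilinear_isBilinear.Build K A V V *:%R *:%R (rep_sub l r)
    (rep_sub_is_bilinear l r).

Lemma induced_succ_is_bilinear (l : {bilinear A -> V -> V})
    (T : {linear V -> A}) : bilinear_for *:%R *:%R (induced_succ l T).
Proof.
by split=> [u'|u] k x y; rewrite /induced_succ ?linearP ?linearPl ?linearPr.
Qed.

HB.instance Definition _ l T :=
  bilinear_isBilinear.Build K V V V *:%R *:%R (induced_succ l T)
    (induced_succ_is_bilinear l T).

Lemma induced_prec_is_bilinear (r : {bilinear A -> V -> V})
    (T : {linear V -> A}) : bilinear_for *:%R *:%R (induced_prec r T).
Proof.
by split=> [u'|u] k x y; rewrite /induced_prec ?linearP ?linearPl ?linearPr.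
Qed.

HB.instance Definition _ r T :=
  bilinear_isBilinear.Build K V V V *:%R *:%R (induced_prec r T)
    (induced_prec_is_bilinear r T).

End Bilinearity.

Section Structures.
Variables (K : fieldType) (A V : lmodType K).

Definition multiplicative (mu : {bilinear A -> A -> A})
    (alpha : {linear A -> A}) : Prop :=
  forall x y, alpha (mu x y) = mu (alpha x) (alpha y).

Definition hom_alternative (mu : {bilinear A -> A -> A})
    (alpha : {linear A -> A}) : Prop :=
  [/\ multiplicative mu alpha,
      forall x y, hom_associator mu alpha x x y = 0
    & forall x y, hom_associator mu alpha y x x = 0].

(* Neither l nor r is required to intertwine alpha and beta. *)
Definition hom_alternative_bimodule (mu : {bilinear A -> A -> A})
    (alpha : {linear A -> A}) (l r : {bilinear A -> V -> V})
    (beta : {linear V -> V}) : Prop :=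
  [/\ forall x v, l (mu x x) (beta v) = l (alpha x) (l x v),
      forall x v, r (mu x x) (beta v) = r (alpha x) (r x v),
      forall x y v,
        r (alpha y) (l x v) - l (alpha x) (r y v) =
        r (mu x y) (beta v) - r (alpha y) (r x v)
    & forall x y v,
        l (mu y x) (beta v) - l (alpha y) (l x v) =
        l (alpha y) (r x v) - r (alpha x) (l y v)].

Definition O_operator (mu : {bilinear A -> A -> A}) (alpha : {linear A -> A})
    (l r : {bilinear A -> V -> V}) (beta : {linear V -> V})
    (T : {linear V -> A}) : Prop :=
  (forall a, alpha (T a) = T (beta a)) /\
  (forall a b, mu (T a) (T b) = T (l (T a) b + r (T b) a)).

(* As a quadruple, not a Hom-algebra: alpha need not be multiplicative
   for prec and succ. *)
Definition hom_pre_alternative (prec succ : {bilinear A -> A -> A})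
    (alpha : {linear A -> A}) : Prop :=
  let star x y := prec x y + succ x y in
  [/\ forall x y z,
        prec (succ x y) (alpha z) - succ (alpha x) (prec y z)
        + prec (prec y x) (alpha z) - prec (alpha y) (star x z) = 0,
      forall x y z,
        prec (succ x y) (alpha z) - succ (alpha x) (prec y z)
        + succ (star x z) (alpha y) - succ (alpha x) (succ z y) = 0,
      forall x y z,
        succ (star x y) (alpha z) - succ (alpha x) (succ y z)
        + succ (star y x) (alpha z) - succ (alpha y) (succ x z) = 0
    & forall x y z,
        prec (prec x y) (alpha z) - prec (alpha x) (star y z)
        + prec (prec x z) (alpha y) - prec (alpha x) (star z y) = 0].

Definition hom_pre_malcev (dot : {bilinear A -> A -> A})
    (alpha : {linear A -> A}) : Prop :=
  let br := commutator dot in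
  multiplicative dot alpha /\
  forall x y z t,
    dot (br (alpha y) (alpha z)) (alpha (dot x t))
    + dot (br (br x y) (alpha z)) (alpha (alpha t))
    + dot (alpha (alpha y)) (dot (br x z) (alpha t))
    - dot (alpha (alpha x)) (dot (alpha y) (dot z t))
    + dot (alpha (alpha z)) (dot (alpha x) (dot y t)) = 0.

Definition malcev_O_operator (br : {bilinear A -> A -> A})
    (alpha : {linear A -> A}) (rho : {bilinear A -> V -> V})
    (beta : {linear V -> V}) (T : {linear V -> A}) : Prop :=
  (forall a, alpha (T a) = T (beta a)) /\
  (forall a b, br (T a) (T b) = T (rho (T a) b - rho (T b) a)).

End Structures.

(* (V, dot, beta) is the Hom-pre-Malcev algebra associated through T to the
   bracket br on A and the action rho of A on V. *)
Definition associated_hom_pre_malcev (K : fieldType) (A V : lmodType K)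
    (br : {bilinear A -> A -> A}) (alpha : {linear A -> A})
    (rho : {bilinear A -> V -> V}) (beta : {linear V -> V})
    (T : {linear V -> A}) (dot : {bilinear V -> V -> V}) : Prop :=
  [/\ malcev_O_operator br alpha rho beta T,
      hom_pre_malcev dot beta
    & forall a b, dot a b = rho (T a) b].

(* The first clause of associated_hom_pre_malcev is automatic for the
   commutator bracket and rho = l - r. *)
Lemma O_operator_malcev (K : fieldType) (A V : lmodType K)
    (mu : {bilinear A -> A -> A}) (alpha : {linear A -> A})
    (l r : {bilinear A -> V -> V}) (beta : {linear V -> V})
    (T : {linear V -> A}) :
  O_operator mu alpha l r beta T ->
  malcev_O_operator (commutator mu) alpha (rep_sub l r) beta T.
Proof.
move=> [TC TM]; split=> // a b.
rewrite /= /commutator /rep_sub !TM -linearB; congr (T _).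
by rewrite opprB addrACA opprD [- l _ _ - _]addrC.
Qed.

(* Main.v *)
(* Since T (a < b + a > b) = T a * T b and T beta = alpha T, each identity of
   the Hom-pre-alternative structure on V is a bimodule identity evaluated on
   the image of T: the first two are the mixed identities, the last two are the
   polarizations of l(x^2) beta = l(alpha x) l(x) and its analogue for r. *)
Require Import Defs.
From mathcomp Require Import all_boot all_order all_algebra.

Import GRing.Theory.
Local Open Scope ring_scope.

(** Evaluate the hypothesis at [x + y] and cancel the two pure squares. A generic [f] lets one
    statement serve both [l] and [r]. *)
Lemma square_action_polarized {K : fieldType} {A V : lmodType K}
    {mu : {bilinear A -> A -> A}} {alpha : {linear A -> A}}
    {f : {bilinear A -> V -> V}} {beta : {linear V -> V}} :
  (forall x v, f (mu x x) (beta v) = f (alpha x) (f x v)) ->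
  forall x y v, f (mu x y) (beta v) + f (mu y x) (beta v) =
                f (alpha x) (f y v) + f (alpha y) (f x v).
Proof.
move=> sqf x y v; have := sqf (x + y) v.
rewrite !(linearD, linearDl) /= !linearDl /= !sqf.
by rewrite -!addrA => /addrI; rewrite !addrA => /addIr ->; rewrite addrC.
Qed.

Theorem theorem3p1 (K : fieldType) (char0 : [pchar K] =i pred0)
    (A V : lmodType K)
    (mu : {bilinear A -> A -> A}) (alpha : {linear A -> A})
    (l r : {bilinear A -> V -> V}) (beta : {linear V -> V})
    (T : {linear V -> A}) :
  hom_alternative mu alpha ->
  hom_alternative_bimodule mu alpha l r beta ->
  O_operator mu alpha l r beta T ->
  hom_pre_alternative (induced_prec r T) (induced_succ l T) beta /\
  (forall dot : {bilinear V -> V -> V},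
     associated_hom_pre_malcev (commutator mu) alpha (rep_sub l r) beta T dot ->
     forall a b : V, dot a b = induced_succ l T a b - induced_prec r T b a).
Proof.
(* The formula for [dot] is [dotE] up to unfolding [rep_sub]. *)
move=> _ [sql sqr rl lr] [TC TM]; split; last by move=> dot [_ _ dotE] a b.
have Tstar a b : T (r (T b) a + l (T a) b) = mu (T a) (T b).
  by rewrite addrC TM.
rewrite /hom_pre_alternative /= /induced_prec /induced_succ.
split=> a b c; rewrite !Tstar -!TC.
- by rewrite rl subrK subrr.
- by rewrite -addrA lr addrA subrK subrr.
(* Regroup as the two terms in [beta c] minus the two composites. *)
- rewrite addrAC -[_ - _ - _]addrA -opprD addrAC; apply/eqP.
  by rewrite subr_eq0; apply/eqP/square_action_polarized.
(* Now the composites carry the plus sign, and in swapped order, whence the final [addrC]. *)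
- rewrite addrAC -[_ - _ - _]addrA -opprD addrAC; apply/eqP.
  by rewrite subr_eq0 (square_action_polarized sqr) addrC.
Qed.
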